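(* With the notation of the context, suppose given a homogeneous Joyce structure on $M$, a cotangent bundle structure $M\subset T_B^*$ with Liouville form $\lambda$ and projection $\rho\colon M\to B$, and a $\mathbb{C}^*$-invariant Lagrangian submanifold $R\subset Z_\infty$, satisfying the transversality assumption $(\star)$. Put $Y=q_\infty^{-1}(R)$, $p=\pi|_Y\colon Y\to M$ and $f=\rho\circ p\colon Y\to B$. Let $\tau|_Y$ be the $\tau$-function on $Y$ defined using the potential $\Theta_0^{\rm H}=i_E(\Omega_0)+\lambda$ on $Z_0=M$. Then for every leaf $L\subset Y$ of the connection $k_1$ on $f\colon Y\to B$ one has $$d\log(\tau|_L)=p^*(\lambda)|_L.$$ Hence $\tau|_Y$ is a $\tau$-function for the strongly-integrable time-dependent Hamiltonian system on $f\colon Y\to B$ associated to these data.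
   Context: Everything is holomorphic. A period structure on a complex manifold $M$ of dimension $n=2d$ is an atlas of distinguished charts whose transition functions are linear maps in $GL_n(\mathbb{Z})$; co-ordinates $(z_1,\dots,z_n)$ of a distinguished chart are called integral linear. They induce local co-ordinates $(z_i,\theta_j)$ on the total space $\pi\colon X=T_M\to M$ by writing tangent vectors as $\sum_i\theta_i\,\partial/\partial z_i$. A Joyce structure on $M$ consists of a period structure, a holomorphic symplectic form $\omega=\frac12\sum_{p,q}\omega_{pq}\,dz_p\wedge dz_q$, with $(\omega_{pq})$ a constant matrix in integral linear co-ordinates, whose inverse matrix $(\eta_{pq})$ has entries in $2\pi i\,\mathbb{Z}$, and a non-linear connection $h\colon\pi^*(T_M)\to T_X$ on $\pi$ of the following form. Set $v_i=v(\partial/\partial z_i)=\partial/\partial\theta_i$ (the vertical lift) and $$h_i=h\left(\frac{\partial}{\partial z_i}\right)=\frac{\partial}{\partial z_i}+\sum_{p,q}\eta_{pq}\frac{\partial^2W}{\partial\theta_i\partial\theta_p}\frac{\partial}{\partial\theta_q},$$ where $W=W(z,\theta)$ is a locally-defined function with $W(z,0)=0=\frac{\partial W}{\partial\theta_i}(z,0)$, satisfying $$\frac{\partial^2W}{\partial\theta_i\partial z_j}-\frac{\partial^2W}{\partial\theta_j\partial z_i}=\sum_{p,q}\eta_{pq}\frac{\partial^2W}{\partial\theta_i\partial\theta_p}\frac{\partial^2W}{\partial\theta_j\partial\theta_q},$$ together with the symmetries: the functions $\frac{\partial^2W}{\partial\theta_i\partial\theta_j}$ are invariant under $\theta\mapsto\theta+2\pi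 i k$ for $k\in\mathbb{Z}^n$; $W(\lambda z,\theta)=\lambda^{-1}W(z,\theta)$ for $\lambda\in\mathbb{C}^*$; and $W(z,-\theta)=-W(z,\theta)$. The connections $h_\epsilon=h+\epsilon^{-1}v$, for $\epsilon\in\mathbb{C}^*\cup\{\infty\}$, are then flat. The Euler vector field on $X$ is $E=\sum_i z_i\,\partial/\partial z_i$ (in the co-ordinates $(z_i,\theta_j)$); the same formula defines a vector field on $M$, also denoted $E$. The Joyce structure is homogeneous if these generate $\mathbb{C}^*$-actions on $X$ and $M$; these then induce a $\mathbb{C}^*$-action on the twistor fibre $Z_\infty$ below. There are closed 2-forms on $X$: $$\Omega_+=\tfrac12\sum\omega_{pq}\,dz_p\wedge dz_q,\qquad 2i\,\Omega_I=-\sum\omega_{pq}\,dz_p\wedge d\theta_q,$$ $$\Omega_-=\tfrac12\sum\omega_{pq}\,d\theta_p\wedge d\theta_q+\sum\frac{\partial^2W}{\partial\theta_p\partial\theta_q}\,d\theta_p\wedge dz_q+\sum\frac{\partial^2W}{\partial z_p\partial\theta_q}\,dz_p\wedge dz_q.$$ For $\epsilon\in\mathbb{C}^*\cup\{\infty\}$ the twistor fibre $Z_\epsilon$ is the space of leaves of the foliation $\mathrm{im}(h_\epsilon)\subset T_X$, with quotient map $q_\epsilon\colon X\to Z_\epsilon$; also $Z_0=M$ and $q_0=\pi$. These leaf spaces are treated as complex manifolds (equivalently, all objects on $Z_\epsilon$ may be viewed as objects on $X$ descending along the foliation). There are symplectic forms $\Omega_\epsilon$ on $Z_\epsilon$ with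 $q_\epsilon^*(\Omega_\epsilon)=\epsilon^{-2}\Omega_++2i\epsilon^{-1}\Omega_I+\Omega_-$ for $\epsilon\in\mathbb{C}^*$, $q_\infty^*(\Omega_\infty)=\Omega_-$, and $\Omega_0=\omega$, $q_0^*(\Omega_0)=\Omega_+$. Set $\Theta_I=i_E(\Omega_I)$, so $d\Theta_I=\Omega_I$. A cotangent bundle structure on $M$ is a complex manifold $B$ and an open embedding $M\subset T_B^*$ such that $\omega$ is the restriction of the canonical symplectic form on $T^*_B$; $\rho\colon M\to B$ is the induced projection and $\lambda$ is the restriction to $M$ of the Liouville 1-form. In co-ordinates $(s_i,t_i)$ on $M$ induced by co-ordinates $t_i$ on $B$, $\omega=\sum_i dt_i\wedge ds_i$ and $\lambda=\sum_i s_i\,dt_i$, so $d(-\lambda)=\omega$. It is assumed that $\mathcal{L}_E(\lambda)=2\lambda$. Let $\beta\in H^0(M,\rho^*(T_B^* ))$ be the tautological section, corresponding to $\lambda$ under $\rho^*(T_B^* )\hookrightarrow T_M^*$. Given a Lagrangian submanifold $R\subset Z_\infty$, set $Y=q_\infty^{-1}(R)\subset X$ with inclusion $i\colon Y\hookrightarrow X$, $p=\pi\circ i$, $f=\rho\circ\pi\circ i\colon Y\to B$. Transversality assumption $(\star)$: for each $b\in B$ the restriction of $q_1\colon X\to Z_1$ to $f^{-1}(b)\subset Y\subset X$ is étale (a local isomorphism). A time-dependent Hamiltonian system consists of a submersion $f\colon Y\to B$ with a relative symplectic form $\Omega$, a flat symplectic connection $k$ on $f$, and a section $\varpi\in H^0(Y,f^*(T_B^*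 ))$. Setting $H_u=(f^*(u),\varpi)$ for vector fields $u$ on $B$, there are connections $k_\epsilon(u)=k(u)+\epsilon^{-1}\Omega^\sharp(dH_u)$; the system is strongly-integrable if all of these are flat. A $\tau$-function for such a system is a locally-defined function $\tau\colon Y\to\mathbb{C}^*$ whose restriction to each leaf $L\subset Y$ of $k_1$ satisfies $d\log(\tau|_L)=\varpi|_L$. It is known that, given a Joyce structure on $M$, a cotangent bundle structure $M\subset T_B^*$ and a Lagrangian submanifold $R\subset Z_\infty$ satisfying the transversality assumption $(\star)$, there is a unique strongly-integrable time-dependent Hamiltonian system on $f\colon Y\to B$ such that: $\Omega$ is induced by $i^*(2i\Omega_I)$; for each $\epsilon\in\mathbb{C}^*$ the connection $k_\epsilon$ satisfies $\mathrm{im}(k_\epsilon)=T_Y\cap\mathrm{im}(h_\epsilon)\subset T_X$; and $\varpi=p^*(\beta)$. This is the Hamiltonian system referred to in the claim. The $\tau$-function on $Y$ (Joyce structure): choose a locally-defined 1-form $\Theta_1$ on $Z_1$ with $d\Theta_1=\Omega_1$ and a 1-form $\Theta_0$ on $Z_0$ with $d\Theta_0=\Omega_0$, $\mathcal L_E(\Theta_0)=2\Theta_0$. Since $\Omega_\infty|_R=0$, the term $q_\infty^*(\Theta_\infty)$ of the general definition is dropped on $Y$, and $\tau|_Y$ is the locally-defined function on $Y$, unique up to multiplication by constants, satisfying $$d\log(\tau|_Y)=i^*\bigl(q_0^*(\Theta_0)+2i\Theta_I-q_1^*(\Theta_1)\bigr).$$ (In $2i\Theta_I$ and $2i\Omega_I$,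 $i=\sqrt{-1}$.) *)

(* Defs.v *)
From HB Require Import structures.
From mathcomp Require Import all_boot all_order all_algebra.
From mathcomp Require Import complex.
From mathcomp Require Import all_classical all_reals all_analysis.

Set Implicit Arguments.
Unset Strict Implicit.
Unset Printing Implicit Defensive.

Import Order.TTheory GRing.Theory Num.Theory.
Import numFieldNormedType.Exports.

Local Open Scope classical_set_scope.
Local Open Scope ring_scope.
Local Open Scope complex_scope.

Section Auxiliary.

Lemma open_setI_preimage (S T : topologicalType) (f : S -> T) (A : set S)
    (O : set T) :
  open A -> (forall x, A x -> {for x, continuous f}) -> open O ->
  open (A `&` f @^-1` O).
Proof.
move=> oA cf oO; rewrite openE => x [Ax Ofx]; rewrite /interior.
by apply: filterI; [exact: open_nbhs_nbhs | apply: (cf x Ax); exact: open_nbhs_nbhs].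
Qed.

Lemma near_eq_is_diff (K : numFieldType) (V W : normedModType K) (f g : V -> W)
    (x : V) : (\forall y \near x, f y = g y) -> differentiable f x ->
  differentiable g x /\ ('d g x = 'd f x :> (V -> W)).
Proof.
move=> fg df.
have cdf : continuous ('d f x) by exact: diff_continuous.
have gE : g \o shift x = cst (g x) + 'd f x +o_ 0 id.
  apply/eqaddoP => e e0.
  have /diff_locallyP[_ fE] := df.
  have := nbhs_singleton fg => fgx.
  move/eqaddoP: fE => /(_ e e0) fE.
  have fg0 : \forall h \near (0 : V), f (h + x) = g (h + x).
    by move: fg; rewrite (near_shift 0 x) subr0.
  near=> h.
  have -> : (g \o shift x - (cst (g x) + 'd f x)) h =
            (f \o shift x - (cst (f x) + 'd f x)) h.
    by rewrite !fctE /= -fgx; congr (_ - _); apply/esym; near: h.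
  by near: h.
have dgE := diff_unique cdf gE.
split; last by rewrite dgE.
by apply/diff_locallyP; rewrite dgE; split.
Unshelve. all: by end_near. Qed.

Lemma continuous_mulmxr (K : numFieldType) m n (A : 'M[K]_(m, n)) :
  continuous (mulmxr A : 'rV[K]_m -> 'rV[K]_n).
Proof.
have -> : (mulmxr A : 'rV[K]_m -> 'rV[K]_n) =
    \sum_(i < m) (fun y : 'rV[K]_m => y 0 i *: row i A).
  by apply/funext => y; rewrite fct_sumE -mulmx_sum_row.
elim/big_ind : _ => [|f g cf cg|i _] x; first exact: cst_continuous.
  exact: (@cvgD _ _ _ (nbhs x) _ f g (f x) (g x) (cf x) (cg x)).
exact: (cvgZr_tmp (@coord_continuous K 1 m 0 i x)).
Qed.

End Auxiliary.

Section Manifolds.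
Variable K : numClosedFieldType.

(* A chart is a map [chart_map] meant on [chart_dom] only, together with a
   local inverse; outside [chart_dom] and its image the values are junk. *)
Record chart (T : topologicalType) (n : nat) := Chart {
  chart_dom : set T;
  chart_map :> T -> 'rV[K]_n;
  chart_inv : 'rV[K]_n -> T }.

Definition is_chart (T : topologicalType) n (c : chart T n) :=
  [/\ open (chart_dom c), open (c @` chart_dom c),
      (forall x, chart_dom c x -> chart_inv c (c x) = x),
      (forall x, chart_dom c x -> {for x, continuous c}) &
      (forall x, chart_dom c x -> {for c x, continuous (chart_inv c)})].

(* Hausdorffness and second countability are not part of this structure: they
   are assumed separately, where wanted.  [chart_at] selects a chart around
   each point.  A map that is complex differentiable at all points of an open
   set is holomorphic there. *)
Record complexManifold (n : nat) := ComplexManifold {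
  cm_sort :> topologicalType;
  atlas : set (chart cm_sort n);
  chart_at : cm_sort -> chart cm_sort n;
  chart_at_atlas : forall x, atlas (chart_at x);
  chart_at_dom : forall x, chart_dom (chart_at x) x;
  atlas_chart : forall c, atlas c -> is_chart c;
  atlas_holo : forall c c', atlas c -> atlas c' ->
    forall x, chart_dom c x -> chart_dom c' x ->
    differentiable (c' \o chart_inv c) (c x) }.

(* The tangent space [T_x M] is ['rV[K]_n], a tangent vector being given by its
   components in the chart [chart_at x].  [tcoord c x v] is the row of
   components of [v : T_x M] in the chart [c], and [tvec c z v] the tangent
   vector at the point with coordinates [z] whose components in [c] are [v]. *)
Definition tcoord n (M : complexManifold n) (c : chart M n) (x : M)
    (v : 'rV[K]_n) : 'rV[K]_n :=
  'd (c \o chart_inv (chart_at x)) (chart_at x x) v.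

Definition tvec n (M : complexManifold n) (c : chart M n) (z : 'rV[K]_n)
    (v : 'rV[K]_n) : 'rV[K]_n :=
  'd (chart_at (chart_inv c z) \o chart_inv c) z v.

(* A period structure: the transition functions of the given atlas, whose
   charts are the distinguished ones, are linear maps in GL_n(Z), acting on
   rows of coordinates from the right. *)
Record periodManifold (n : nat) := PeriodManifold {
  pm_manifold :> complexManifold n;
  period_transition : forall c c' : chart pm_manifold n,
    atlas c -> atlas c' -> exists2 A : 'M[int]_n, A \in unitmx &
    forall x, chart_dom c x -> chart_dom c' x ->
      c' x = c x *m map_mx intr A }.

End Manifolds.

Section ChartLemmas.
Variable K : numClosedFieldType.

Lemma open_chart_image (T : topologicalType) n (c : chart K T n) (O : set T) :
  is_chart c -> open O -> O `<=` chart_dom c -> open (c @` O).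
Proof.
move=> [_ oc cK _ cinv] oO Od.
have -> : c @` O = c @` chart_dom c `&` chart_inv c @^-1` O.
  apply/seteqP; split=> [_ [x Ox <-]|_ [[x dx <-] /=]].
    by split; [exists x => //; exact: Od | rewrite /= cK //; exact: Od].
  by rewrite cK// => Ox; exists x.
by apply: open_setI_preimage => // _ [x dx <-]; exact: cinv.
Qed.

Lemma chart_trans_near n (M : complexManifold K n) (c c' c'' : chart K M n)
    (x : M) : atlas c -> atlas c' -> chart_dom c x -> chart_dom c' x ->
  \forall z \near c x, ((c'' \o chart_inv c') \o (c' \o chart_inv c)) z =
    (c'' \o chart_inv c) z.
Proof.
move=> ac ac' xc xc'.
have [oc' _ c'K _ _] := atlas_chart ac'.
have [_ _ cK _ cinv] := atlas_chart ac.
have : \forall z \near c x, chart_dom c' (chart_inv c z).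
  by apply: (cinv x xc); rewrite cK//; exact: open_nbhs_nbhs.
by apply: filterS => z dz /=; rewrite c'K.
Qed.

Lemma diff_chart_trans n (M : complexManifold K n) (c c' c'' : chart K M n)
    (x : M) (v : 'rV[K]_n) : atlas c -> atlas c' -> atlas c'' ->
  chart_dom c x -> chart_dom c' x -> chart_dom c'' x ->
  'd (c'' \o chart_inv c') (c' x) ('d (c' \o chart_inv c) (c x) v) =
  'd (c'' \o chart_inv c) (c x) v.
Proof.
move=> ac ac' ac'' xc xc' xc''.
have [_ _ cK _ _] := atlas_chart ac.
have d1 := atlas_holo ac ac' xc xc'.
have E : (c' \o chart_inv c) (c x) = c' x by rewrite /comp cK.
have d2 : differentiable (c'' \o chart_inv c') ((c' \o chart_inv c) (c x)).
  by rewrite E; exact: (atlas_holo ac' ac'').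
have near_tr := chart_trans_near c'' ac ac' xc xc'.
have [_ E1] := near_eq_is_diff near_tr (differentiable_comp d1 d2).
apply: etrans (esym (congr1 (fun f => f v) E1)).
apply: etrans (esym (congr1 (fun f => f v) (diff_comp d1 d2))).
exact: (congr1 (fun p => 'd (c'' \o chart_inv c') p
  ('d (c' \o chart_inv c) (c x) v)) (esym E)).
Qed.

Lemma diff_chart_id n (M : complexManifold K n) (c : chart K M n) (x : M)
    (v : 'rV[K]_n) : atlas c -> chart_dom c x ->
  'd (c \o chart_inv c) (c x) v = v.
Proof.
move=> ac xc; have [_ oc cK _ _] := atlas_chart ac.
have nid : \forall z \near c x, idfun z = (c \o chart_inv c) z.
  have : \forall z \near c x, (c @` chart_dom c) z.
    by apply: open_nbhs_nbhs; split => //; exists x.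
  by apply: filterS => _ [y dy <-] /=; rewrite cK.
have cid : continuous (idfun : 'rV[K]_n -> 'rV[K]_n) by move=> ? //.
have [_ E] := near_eq_is_diff nid (@linear_differentiable K _ _ idfun (c x) cid).
apply: etrans (congr1 (fun f => f v) E) _.
exact: (congr1 (fun f => f v) (@diff_lin K _ _ idfun (c x) cid)).
Qed.

Lemma tvecK n (M : complexManifold K n) (c : chart K M n) (x : M)
    (v : 'rV[K]_n) : atlas c -> chart_dom c x ->
  tcoord c x (tvec c (c x) v) = v.
Proof.
move=> ac xc; have [_ _ cK _ _] := atlas_chart ac.
have ax := chart_at_atlas x; have dx := chart_at_dom x.
rewrite /tcoord /tvec cK//.
apply: etrans (diff_chart_trans v ac ax ac xc dx xc) _.
exact: (diff_chart_id v ac xc).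
Qed.

Lemma tcoordK n (M : complexManifold K n) (c : chart K M n) (x : M)
    (v : 'rV[K]_n) : atlas c -> chart_dom c x ->
  tvec c (c x) (tcoord c x v) = v.
Proof.
move=> ac xc; have [_ _ cK _ _] := atlas_chart ac.
have ax := chart_at_atlas x; have dx := chart_at_dom x.
rewrite /tcoord /tvec cK//.
apply: etrans (diff_chart_trans v ax ac ax dx xc dx) _.
exact: (diff_chart_id v ax dx).
Qed.

Lemma diff_period_trans n (M : periodManifold K n) (c c' : chart K M n)
    (A : 'M[int]_n) (x : M) (v : 'rV[K]_n) :
  atlas c -> atlas c' -> chart_dom c x -> chart_dom c' x ->
  (forall y, chart_dom c y -> chart_dom c' y -> c' y = c y *m map_mx intr A) ->
  'd (c' \o chart_inv c) (c x) v = v *m map_mx intr A.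
Proof.
move=> ac ac' xc xc' cA.
have [oc oic cK cc cinv] := atlas_chart ac.
have [oc' _ _ _ _] := atlas_chart ac'.
have ntr : \forall z \near c x,
    mulmxr (map_mx intr A) z = (c' \o chart_inv c) z.
  have : \forall z \near c x, (c @` (chart_dom c `&` chart_dom c')) z.
    apply: open_nbhs_nbhs; split; last by exists x.
    by apply: open_chart_image (atlas_chart ac) _ _ => //; exact: openI.
  by apply: filterS => _ [y [dy dy'] <-] /=; rewrite cK// cA.
have lin := @continuous_mulmxr K n n (map_mx intr A).
have [_ E] := near_eq_is_diff ntr (@linear_differentiable K _ _ (mulmxr (map_mx intr A)) (c x) lin).
apply: etrans (congr1 (fun f => f v) E) _.
exact: (congr1 (fun f => f v) (@diff_lin K _ _ (mulmxr (map_mx intr A)) (c x) lin)).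
Qed.

End ChartLemmas.

Section TangentBundle.
Variable K : numClosedFieldType.
Variables (n : nat) (M : periodManifold K n).
Implicit Types c : chart K M n.

(* The total space of [T_M]: pairs of a point [m] and a tangent vector at [m],
   given as above by its components in [chart_at m]. *)
Definition tangentBundle : Type := (M * 'rV[K]_n)%type.

HB.instance Definition _ := Choice.copy tangentBundle (M * 'rV[K]_n)%type.

(* The co-ordinates (z, theta) induced by a distinguished chart. *)
Definition tb_map c (x : tangentBundle) : 'rV[K]_(n + n) :=
  row_mx (c x.1) (tcoord c x.1 x.2).

Definition tb_inv c (y : 'rV[K]_(n + n)) : tangentBundle :=
  (chart_inv c (lsubmx y), tvec c (lsubmx y) (rsubmx y)).

Definition tb_dom c : set tangentBundle := [set x | chart_dom c x.1].

Definition tb_open (U : set tangentBundle) : Prop :=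
  forall c, atlas c -> open (tb_map c @` (U `&` tb_dom c)).

Lemma tb_mapK c x : atlas c -> tb_dom c x -> tb_inv c (tb_map c x) = x.
Proof.
case: x => m v ac mc; have [_ _ cK _ _] := atlas_chart ac.
by rewrite /tb_inv /tb_map row_mxKl row_mxKr /= cK// tcoordK.
Qed.

Lemma tb_map_image c (U : set M) : atlas c -> U `<=` chart_dom c ->
  tb_map c @` [set x | U x.1] = lsubmx @^-1` (c @` U).
Proof.
move=> ac Uc; apply/seteqP; split=> [_ [[m v] Um <-]|y [m Um /= my]].
  by exists m => //=; rewrite /tb_map row_mxKl.
exists (m, tvec c (c m) (rsubmx y)) => //.
by rewrite /tb_map /= tvecK// ?hsubmxK ?my ?hsubmxK//; exact: Uc.
Qed.

Lemma tb_trans c c' : atlas c -> atlas c' ->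
  exists T : 'M[K]_(n + n), forall x, tb_dom c x -> tb_dom c' x ->
    tb_map c' x = tb_map c x *m T.
Proof.
move=> ac ac'; have [A _ cA] := period_transition ac ac'.
exists (block_mx (map_mx intr A) 0 0 (map_mx intr A)) => -[m v] mc mc'.
rewrite /tb_map /= mul_row_block !mulmx0 addr0 add0r cA//.
congr row_mx.
apply: etrans (esym (diff_chart_trans v (chart_at_atlas m) ac ac'
  (chart_at_dom m) mc mc')) _.
exact: (@diff_period_trans _ _ _ _ _ A).
Qed.

Lemma tb_map_inj c x y : atlas c -> tb_dom c x -> tb_dom c y ->
  tb_map c x = tb_map c y -> x = y.
Proof. by move=> ac xc yc e; rewrite -(tb_mapK ac xc) -(tb_mapK ac yc) e. Qed.

Lemma open_tb_dom c (U : set M) : open U -> tb_open [set x | U x.1].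
Proof.
move=> oU c' ac'; rewrite (_ : _ `&` _ = [set x | (U `&` chart_dom c') x.1])//.
rewrite tb_map_image//.
apply: open_comp => [y _|]; first exact: continuous_lsubmx.
apply: (open_chart_image (atlas_chart ac')) => //.
by apply: openI => //; have [] := atlas_chart ac'.
Qed.

Fact tb_openT : tb_open setT.
Proof.
move=> c ac; rewrite setTI tb_map_image//.
apply: open_comp => [y _|]; first exact: continuous_lsubmx.
by have [] := atlas_chart ac.
Qed.

Fact tb_openI : setI_closed tb_open.
Proof.
move=> U V oU oV c ac.
rewrite (_ : _ @` _ =
  tb_map c @` (U `&` tb_dom c) `&` tb_map c @` (V `&` tb_dom c)).
  by apply: openI; [exact: oU | exact: oV].
apply/seteqP; split=> [_ [x [[Ux Vx] xc] <-]|y].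
  by split; exists x.
move=> [[x [Ux xc] <-] [x' [Vx' x'c] /(tb_map_inj ac x'c xc) xx']].
by exists x => //; split=> //; split=> //; rewrite -xx'.
Qed.

Fact tb_open_bigcup (I : Type) (f : I -> set tangentBundle) :
  (forall i, tb_open (f i)) -> tb_open (\bigcup_i f i).
Proof.
move=> of_ c ac; rewrite setI_bigcupl image_bigcup.
by apply: bigcup_open => i _; exact: of_.
Qed.

HB.instance Definition _ :=
  isOpenTopological.Build tangentBundle tb_openT tb_openI tb_open_bigcup.

Lemma tb_openE (U : set tangentBundle) : open U = tb_open U.
Proof. by []. Qed.

Definition tb_chart c : chart K tangentBundle (n + n) :=
  Chart (tb_dom c) (tb_map c) (tb_inv c).

Lemma tb_near c x (O : set 'rV[K]_(n + n)) : atlas c -> tb_dom c x ->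
  nbhs (tb_map c x) O -> nbhs x (tb_map c @^-1` O).
Proof.
move=> ac xc; rewrite nbhsE => -[W [oW Wx] WO].
rewrite nbhsE; exists (tb_map c @^-1` W `&` tb_dom c); last by move=> y [Oy _]; exact: WO.
split=> //; rewrite tb_openE => c' ac'.
have [T cT] := tb_trans ac' ac.
have [oc _ _ _ _] := atlas_chart ac; have [oc' _ _ _ _] := atlas_chart ac'.
rewrite (_ : _ @` _ = tb_map c' @` [set y | (chart_dom c `&` chart_dom c') y.1]
  `&` mulmxr T @^-1` W).
  apply: openI.
    rewrite tb_map_image//; apply: open_comp => [y _|].
      exact: continuous_lsubmx.
    by apply: (open_chart_image (atlas_chart ac')) => //; exact: openI.
  by apply: open_comp => // y _; exact: continuous_mulmxr.
apply/seteqP; split=> [_ [y [[Oy yc] yc'] <-]|_ [[y [yc yc'] <-] /= Oy]].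
  by split; [exists y | rewrite /= -cT].
by exists y => //; split=> //; split=> //=; rewrite cT.
Qed.

Fact tb_is_chart c : atlas c -> is_chart (tb_chart c).
Proof.
move=> ac; have [oc oic _ _ _] := atlas_chart ac; split.
- exact: open_tb_dom.
- rewrite /= (_ : tb_dom c = [set x | chart_dom c x.1])// tb_map_image//.
  by apply: open_comp => // y _; exact: continuous_lsubmx.
- by move=> x; exact: tb_mapK.
- by move=> x xc O; exact: tb_near.
- move=> x xc O; rewrite /= tb_mapK// => /nbhs_interior.
  set U := interior O => Ux.
  have oU : open U by exact: open_interior.
  rewrite /nbhs/=.
  have oi := (oU : tb_open U) _ ac.
  have : nbhs (tb_map c x) (tb_map c @` (U `&` tb_dom c)).
    apply: open_nbhs_nbhs; split=> //; exists x => //; split=> //.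
    by move: Ux => /nbhs_singleton.
  apply: filterS => _ [y [Uy yc] <-] /=.
  by rewrite tb_mapK//; exact: interior_subset.
Qed.

Fact tb_holo c c' x : atlas c -> atlas c' -> tb_dom c x -> tb_dom c' x ->
  differentiable (tb_chart c' \o chart_inv (tb_chart c)) (tb_chart c x).
Proof.
move=> ac ac' xc xc'; have [T cT] := tb_trans ac ac'.
have [oc _ _ _ _] := atlas_chart ac; have [oc' _ _ _ _] := atlas_chart ac'.
have lin := @continuous_mulmxr K _ _ T.
suff ntr : \forall y \near tb_map c x,
    mulmxr T y = (tb_map c' \o tb_inv c) y.
  have [//] := near_eq_is_diff ntr
    (@linear_differentiable K _ _ (mulmxr T) (tb_map c x) lin).
have : nbhs (tb_map c x) (tb_map c @`
    [set y | (chart_dom c `&` chart_dom c') y.1]).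
  apply: open_nbhs_nbhs; split; last by exists x.
  rewrite tb_map_image//; apply: open_comp => [y _|].
    exact: continuous_lsubmx.
  by apply: (open_chart_image (atlas_chart ac)) => //; exact: openI.
by apply: filterS => _ [y [yc yc'] <-] /=; rewrite tb_mapK// cT.
Qed.

Definition tb_atlas : set (chart K tangentBundle (n + n)) :=
  tb_chart @` @atlas K n M.

Fact tb_chart_at_atlas (x : tangentBundle) :
  tb_atlas (tb_chart (chart_at x.1)).
Proof. by exists (chart_at x.1) => //; exact: chart_at_atlas. Qed.

Fact tb_chart_at_dom (x : tangentBundle) :
  chart_dom (tb_chart (chart_at x.1)) x.
Proof. exact: chart_at_dom. Qed.

Fact tb_atlas_chart (c : chart K tangentBundle (n + n)) :
  tb_atlas c -> is_chart c.
Proof. by move=> [c' ac' <-]; exact: tb_is_chart. Qed.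

Fact tb_atlas_holo (c c' : chart K tangentBundle (n + n)) :
  tb_atlas c ->
  tb_atlas c' ->
  forall x, chart_dom c x -> chart_dom c' x ->
  differentiable (c' \o chart_inv c) (c x).
Proof. by move=> [c1 a1 <-] [c2 a2 <-] x xc xc'; exact: tb_holo. Qed.

Definition tangentManifold : complexManifold K (n + n) :=
  ComplexManifold tb_chart_at_atlas tb_chart_at_dom tb_atlas_chart
    tb_atlas_holo.

End TangentBundle.

Section Calculus.
Variable K : numClosedFieldType.

Definition holomorphic_at m n (M : complexManifold K m) (N : complexManifold K n)
    (f : M -> N) (x : M) : Prop :=
  {for x, continuous f} /\
  differentiable (chart_at (f x) \o f \o chart_inv (chart_at x)) (chart_at x x).

Definition holomorphic m n (M : complexManifold K m) (N : complexManifold K n)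
    (f : M -> N) : Prop := forall x, holomorphic_at f x.

Definition mdiff m n (M : complexManifold K m) (N : complexManifold K n)
    (f : M -> N) (x : M) (v : 'rV[K]_m) : 'rV[K]_n :=
  'd (chart_at (f x) \o f \o chart_inv (chart_at x)) (chart_at x x) v.

Definition immersion m n (M : complexManifold K m) (N : complexManifold K n)
    (f : M -> N) : Prop :=
  holomorphic f /\ forall x, injective (mdiff f x).

Definition submersion m n (M : complexManifold K m) (N : complexManifold K n)
    (f : M -> N) : Prop :=
  holomorphic f /\ forall x w, exists v, mdiff f x v = w.

(* Injective immersions that are homeomorphisms onto their image. *)
Definition embedding m n (M : complexManifold K m) (N : complexManifold K n)
    (f : M -> N) : Prop :=
  [/\ immersion f, injective f &
      forall U : set M, open U -> exists2 V : set N, open V & U = f @^-1` V].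

Definition etale m n (M : complexManifold K m) (N : complexManifold K n)
    (f : M -> N) : Prop :=
  holomorphic f /\
  forall x, exists U : set M, exists g : N -> M,
    [/\ open U, U x, open (f @` U), (forall y, U y -> g (f y) = y) &
        forall z, (f @` U) z -> holomorphic_at g z].

Section OneManifold.
Variables (n : nat) (M : complexManifold K n).

(* Functions, vector fields and forms, of which only the values on some open
   set may matter. *)
Definition vfield := M -> 'rV[K]_n.
Definition form1 := M -> 'rV[K]_n -> K.
Definition form2 := M -> 'rV[K]_n -> 'rV[K]_n -> K.

Definition fdiff (g : M -> K) (x : M) (v : 'rV[K]_n) : K :=
  'd (g \o chart_inv (chart_at x)) (chart_at x x) v.

Definition dlog (g : M -> K) : form1 := fun x v => (g x)^-1 * fdiff g x v.

Definition vfield_in (x : M) (u : vfield) (z : 'rV[K]_n) : 'rV[K]_n :=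
  tcoord (chart_at x) (chart_inv (chart_at x) z) (u (chart_inv (chart_at x) z)).

Definition form1_in (x : M) (a : form1) (v : 'rV[K]_n) (z : 'rV[K]_n) : K :=
  a (chart_inv (chart_at x) z) (tvec (chart_at x) z v).

Definition form2_in (x : M) (Om : form2) (v w : 'rV[K]_n) (z : 'rV[K]_n) : K :=
  Om (chart_inv (chart_at x) z)
    (tvec (chart_at x) z v) (tvec (chart_at x) z w).

Definition holo_fun (V : set M) (g : M -> K) : Prop :=
  forall x, V x -> differentiable (g \o chart_inv (chart_at x)) (chart_at x x).

Definition holo_vfield (V : set M) (u : vfield) : Prop :=
  forall x, V x -> differentiable (vfield_in x u) (chart_at x x).

Definition holo_form1 (V : set M) (a : form1) : Prop :=
  forall x, V x -> linear (a x) /\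
    forall v, differentiable (form1_in x a v) (chart_at x x).

Definition holo_form2 (V : set M) (Om : form2) : Prop :=
  forall x, V x ->
    [/\ forall v, linear (Om x v), forall w, linear (Om x ^~ w),
        forall v, Om x v v = 0 &
        forall v w, differentiable (form2_in x Om v w) (chart_at x x)].

(* Exterior derivative of 1-forms: d a (u, v) = u(a(v)) - v(a(u)) for u, v
   constant in a chart. *)
Definition ext_d1 (a : form1) : form2 := fun x u v =>
  'D_u (form1_in x a v) (chart_at x x) - 'D_v (form1_in x a u) (chart_at x x).

Definition closed2 (Om : form2) : Prop := forall x u v w,
  'D_u (form2_in x Om v w) (chart_at x x) +
  'D_v (form2_in x Om w u) (chart_at x x) +
  'D_w (form2_in x Om u v) (chart_at x x) = 0.

Definition symplectic_form (Om : form2) : Prop :=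
  [/\ holo_form2 setT Om, closed2 Om &
      forall x u, (forall v, Om x u v = 0) -> u = 0].

Definition interior_product (u : vfield) (Om : form2) : form1 := fun x => Om x (u x).

Definition bracket (u v : vfield) : vfield := fun x =>
  'D_(u x) (vfield_in x v) (chart_at x x) -
  'D_(v x) (vfield_in x u) (chart_at x x).

(* (L_u a)(v) = u(a(v)) - a([u, v]), for v constant in a chart. *)
Definition lie_deriv1 (u : vfield) (a : form1) : form1 := fun x v =>
  'D_(u x) (form1_in x a v) (chart_at x x) +
  a x ('D_v (vfield_in x u) (chart_at x x)).

Definition deriv_along (u : vfield) (g : M -> K) : M -> K :=
  fun x => fdiff g x (u x).

Definition wedge2 (a b : 'rV[K]_n -> K) (u v : 'rV[K]_n) : K :=
  a u * b v - a v * b u.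

(* [act], restricted to nonzero scalars, is a holomorphic action of C^* on [M]
   generated by the vector field [E]. *)
Record Cstar_action (act : K -> M -> M) (E : vfield) : Prop := {
  act1 : forall x, act 1 x = x;
  actM : forall a b x, a != 0 -> b != 0 -> act (a * b) x = act a (act b x);
  act_continuous : forall a x, a != 0 ->
    {for (a, x), continuous (fun p : K * M => act p.1 p.2)};
  act_holomorphic : forall a x, a != 0 ->
    differentiable (fun p : K * 'rV[K]_n =>
      chart_at (act a x) (act p.1 (chart_inv (chart_at x) p.2)))
      (a, chart_at x x);
  act_generated : forall x,
    'D_1 (fun a : K => chart_at x (act a x)) 1 = E x }.

End OneManifold.

Definition pull1 m n (M : complexManifold K m) (N : complexManifold K n)
    (f : M -> N) (a : form1 N) : form1 M :=
  fun x v => a (f x) (mdiff f x v).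

Definition pull2 m n (M : complexManifold K m) (N : complexManifold K n)
    (f : M -> N) (Om : form2 N) : form2 M :=
  fun x u v => Om (f x) (mdiff f x u) (mdiff f x v).

(* Foliations, given by the distribution of their tangent spaces. *)
Section Foliations.
Variables (n : nat) (M : complexManifold K n) (D : M -> set 'rV[K]_n).

Definition integral_manifold k (L : complexManifold K k) (l : L -> M) : Prop :=
  [/\ connected [set: L], [set: L] !=set0, immersion l, injective l &
      forall y, range (mdiff l y) = D (l y)].

Definition is_leaf k (L : complexManifold K k) (l : L -> M) : Prop :=
  integral_manifold l /\
  forall (L' : complexManifold K k) (l' : L' -> M),
    integral_manifold l' -> range l `<=` range l' -> range l' = range l.

(* [q] exhibits [Z] as the space of leaves, these having dimension [k]. *)
Definition leaf_space k m (Z : complexManifold K m) (q : M -> Z) : Prop :=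
  [/\ submersion q, range q = setT &
      forall z, exists (L : complexManifold K k) (l : L -> M),
        is_leaf l /\ range l = q @^-1` [set z]].

End Foliations.

(* A connection on [f : Y -> B], as a map f^*(T_B) -> T_Y. *)
Section Connections.
Variables (m n : nat) (Y : complexManifold K m) (B : complexManifold K n).
Variable f : Y -> B.

Definition hlift (k : Y -> 'rV[K]_n -> 'rV[K]_m) (u : vfield B) : vfield Y :=
  fun y => k y (u (f y)).

Definition connection (k : Y -> 'rV[K]_n -> 'rV[K]_m) : Prop :=
  [/\ forall y, linear (k y),
      forall y u, mdiff f y (k y u) = u &
      forall (V : set B) (u : vfield B), open V -> holo_vfield V u ->
        holo_vfield (f @^-1` V) (hlift k u)].

(* Flatness of a connection, given by its action on vector fields on [B]. *)
Definition flat_connection (k : vfield B -> vfield Y) : Prop :=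
  forall (V : set B) (u v : vfield B), open V ->
    holo_vfield V u -> holo_vfield V v ->
    forall y, V (f y) -> bracket (k u) (k v) y = k (bracket u v) y.

Definition vertical (y : Y) : set 'rV[K]_m := [set v | mdiff f y v = 0].

Definition vertical_vfield (V : set Y) (w : vfield Y) : Prop :=
  holo_vfield V w /\ forall y, V y -> vertical y (w y).

(* Only the values of [Om] on vertical vectors matter. *)
Record relative_symplectic (Om : form2 Y) : Prop := {
  relsym_linear : forall y a u u' v,
    vertical y u -> vertical y u' -> vertical y v ->
    Om y (a *: u + u') v = a * Om y u v + Om y u' v;
  relsym_skew : forall y u v, vertical y u -> vertical y v ->
    Om y u v = - Om y v u;
  relsym_nondegenerate : forall y u, vertical y u ->
    (forall v, vertical y v -> Om y u v = 0) -> u = 0;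
  relsym_holo : forall (V : set Y) (u v : vfield Y), open V ->
    vertical_vfield V u -> vertical_vfield V v ->
    holo_fun V (fun y => Om y (u y) (v y));
  relsym_closed : forall (V : set Y) (u v w : vfield Y), open V ->
    vertical_vfield V u -> vertical_vfield V v -> vertical_vfield V w ->
    forall y, V y ->
    deriv_along u (fun y => Om y (v y) (w y)) y +
    deriv_along v (fun y => Om y (w y) (u y)) y +
    deriv_along w (fun y => Om y (u y) (v y)) y -
    Om y (bracket u v y) (w y) - Om y (bracket v w y) (u y) -
    Om y (bracket w u y) (v y) = 0 }.

(* Lifted vector fields preserve [Om]: L_{k(u)} Om = 0 on the fibres. *)
Definition symplectic_connection (Om : form2 Y)
    (k : Y -> 'rV[K]_n -> 'rV[K]_m) : Prop :=
  forall (V : set B) (u : vfield B) (U : set Y) (v w : vfield Y),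
    open V -> holo_vfield V u -> open U -> U `<=` f @^-1` V ->
    vertical_vfield U v -> vertical_vfield U w ->
    forall y, U y ->
    deriv_along (hlift k u) (fun y => Om y (v y) (w y)) y =
    Om y (bracket (hlift k u) v y) (w y) + Om y (v y) (bracket (hlift k u) w y).

(* [ham_varpi y] is a linear form on T_{f(y)} B. *)
Record hamSystem := HamSystem {
  ham_form : form2 Y;
  ham_conn : Y -> 'rV[K]_n -> 'rV[K]_m;
  ham_varpi : Y -> 'rV[K]_n -> K;
  ham_submersion : submersion f;
  ham_symplectic : relative_symplectic ham_form;
  ham_connection : connection ham_conn;
  ham_flat : flat_connection (hlift ham_conn);
  ham_symplectic_conn : symplectic_connection ham_form ham_conn;
  ham_varpi_linear : forall y, linear (ham_varpi y);
  ham_varpi_holo : forall (V : set B) (u : vfield B), open V ->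
    holo_vfield V u -> holo_fun (f @^-1` V) (fun y => ham_varpi y (u (f y))) }.

Variable H : hamSystem.

Definition hamiltonian (u : vfield B) (y : Y) : K := ham_varpi H y (u (f y)).

(* The vertical vector X with Om(w, X) = a(w) for all vertical w.  This is the
   sign for which the Hamiltonian systems attached to Joyce structures below
   have im(k_eps) = T_Y /\ im(h_eps). *)
Definition sharp (y : Y) (a : 'rV[K]_m -> K) : 'rV[K]_m :=
  xget 0 [set X | vertical y X /\
    forall w, vertical y w -> ham_form H y w X = a w].

Definition k_eps (eps : K) (u : vfield B) : vfield Y := fun y =>
  hlift (ham_conn H) u y + eps^-1 *: sharp y (fdiff (hamiltonian u) y).

(* The image of [k_eps] in T_Y; vectors of T_{f(y)} B are extended to local
   vector fields. *)
Definition im_k_eps (eps : K) (y : Y) : set 'rV[K]_m :=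
  [set w | exists (V : set B) (u : vfield B),
     [/\ open V, V (f y), holo_vfield V u & w = k_eps eps u y]].

Definition strongly_integrable : Prop :=
  forall eps, eps != 0 -> flat_connection (k_eps eps).

(* [tau], defined on the open set [V], is a tau-function. *)
Definition ham_tau_function (V : set Y) (tau : Y -> K) : Prop :=
  [/\ open V, holo_fun V tau, forall y, V y -> tau y != 0 &
      forall (L : complexManifold K n) (l : L -> Y),
        is_leaf (im_k_eps 1) l ->
        forall x, V (l x) -> forall v,
        dlog (tau \o l) x v =
        ham_varpi H (l x) (mdiff f (l x) (mdiff l x v))].

End Connections.
End Calculus.

Section Euler.
Variables (K : numClosedFieldType) (n : nat) (M : periodManifold K n).

Definition tb_proj (x : tangentManifold M) : M := x.1.

(* The vector fields sum_i z_i d/dz_i on M and on the total space of T_M, in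
   the distinguished chart [chart_at m] and its induced co-ordinates. *)
Definition euler : vfield M := fun m => chart_at m m.

Definition euler_tb : vfield (tangentManifold M) := fun x =>
  row_mx (euler (tb_proj x)) 0.

End Euler.

Arguments tb_proj {K n M} x.
Arguments euler {K n} M m.
Arguments euler_tb {K n} M x.

(* [K] is to be the field of complex numbers, and [tpi] the number 2 pi i. *)
Section Joyce.
Variables (K : numClosedFieldType) (tpi : K).

Section Coordinates.
Variable n : nat.

Definition e_ (i : 'I_n) : 'rV[K]_n := delta_mx 0 i.
Definition ez (i : 'I_n) : 'rV[K]_(n + n) := row_mx (e_ i) 0.
Definition eth (i : 'I_n) : 'rV[K]_(n + n) := row_mx 0 (e_ i).
Definition dz (i : 'I_n) (u : 'rV[K]_(n + n)) : K := u 0 (lshift n i).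
Definition dth (i : 'I_n) (u : 'rV[K]_(n + n)) : K := u 0 (rshift n i).

Definition D2 (W : 'rV[K]_(n + n) -> K) (a b y : 'rV[K]_(n + n)) : K :=
  'D_a (fun y' => 'D_b W y') y.

End Coordinates.

Section Structure.
Variables (n : nat) (M : periodManifold K n).

Local Notation X := (tangentManifold M).

(* The vertical lift v : pi^*(T_M) -> T_X. *)
Definition vlift (x : X) (u : 'rV[K]_n) : 'rV[K]_(n + n) := row_mx 0 u.

(* The data (omega_pq), (eta_pq) and W = W(z, theta) on pi^-1(U), for some
   neighbourhood U of [m0] and some integral linear co-ordinates on U; here
   pi^-1(U) is z(U) x C^n in these co-ordinates. *)
Record local_potential (omega : form2 M) (h : X -> 'rV[K]_n -> 'rV[K]_(n + n))
    (m0 : M) := LocalPotential {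
  lp_nbhd : set M;
  lp_chart : chart K M n;
  lp_omega : 'M[K]_n;
  lp_eta : 'M[K]_n;
  lp_W : 'rV[K]_(n + n) -> K;
  lp_open : open lp_nbhd;
  lp_mem : lp_nbhd m0;
  lp_atlas : atlas lp_chart;
  lp_dom : lp_nbhd `<=` chart_dom lp_chart;
  lp_omegaE : forall m p q, lp_nbhd m ->
    omega m (tvec lp_chart (lp_chart m) (e_ p))
            (tvec lp_chart (lp_chart m) (e_ q)) = lp_omega p q;
  lp_eta_inv : lp_eta *m lp_omega = 1%:M;
  lp_eta_int : forall p q, exists k : int, lp_eta p q = tpi * k%:~R;
  lp_W_holo : forall z th, (lp_chart @` lp_nbhd) z ->
    differentiable lp_W (row_mx z th);
  lp_W0 : forall z, (lp_chart @` lp_nbhd) z -> lp_W (row_mx z 0) = 0;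
  lp_dW0 : forall z i, (lp_chart @` lp_nbhd) z ->
    'D_(eth i) lp_W (row_mx z 0) = 0;
  lp_pde : forall z th i j, (lp_chart @` lp_nbhd) z ->
    let y := row_mx z th in
    D2 lp_W (eth i) (ez j) y - D2 lp_W (eth j) (ez i) y =
    \sum_p \sum_q lp_eta p q * D2 lp_W (eth i) (eth p) y
                             * D2 lp_W (eth j) (eth q) y;
  lp_periodic : forall z th (k : 'rV[int]_n) i j, (lp_chart @` lp_nbhd) z ->
    D2 lp_W (eth i) (eth j) (row_mx z (th + tpi *: map_mx intr k)) =
    D2 lp_W (eth i) (eth j) (row_mx z th);
  lp_homogeneous : forall (a : K) z th, a != 0 ->
    (lp_chart @` lp_nbhd) z -> (lp_chart @` lp_nbhd) (a *: z) ->
    lp_W (row_mx (a *: z) th) = a^-1 * lp_W (row_mx z th);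
  lp_odd : forall z th, (lp_chart @` lp_nbhd) z ->
    lp_W (row_mx z (- th)) = - lp_W (row_mx z th);
  lp_conn : forall (x : X) i, lp_nbhd (tb_proj x) ->
    tcoord (tb_chart lp_chart : chart K X (n + n)) x
      (h x (tvec lp_chart (lp_chart (tb_proj x)) (e_ i))) =
    ez i + \sum_p \sum_q
      (lp_eta p q * D2 lp_W (eth i) (eth p) (tb_map lp_chart x)) *: eth q }.

(* The connection and the normalisation determine W on pi^-1(U), so that nothing
   below depends on the choices made in [joyce_potential]. *)
Record joyceStructure := JoyceStructure {
  joyce_omega : form2 M;
  joyce_h : X -> 'rV[K]_n -> 'rV[K]_(n + n);
  joyce_symplectic : symplectic_form joyce_omega;
  joyce_connection : connection tb_proj joyce_h;
  joyce_potential : forall m, local_potential joyce_omega joyce_h m }.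

Variable J : joyceStructure.

(* The connection h_eps = h + eps^-1 v and its image, [None] standing for
   eps = infinity. *)
Definition h_eps (eps : option K) (x : X) (u : 'rV[K]_n) : 'rV[K]_(n + n) :=
  if eps is Some e then joyce_h J x u + e^-1 *: vlift x u else joyce_h J x u.

Definition im_h_eps (eps : option K) (x : X) : set 'rV[K]_(n + n) :=
  range (h_eps eps x).

(* Components of tangent vectors to X at x refer to the co-ordinates induced by
   the distinguished chart [chart_at (tb_proj x)]. *)
Definition omega_at (x : X) (p q : 'I_n) : K :=
  joyce_omega J (tb_proj x) (e_ p) (e_ q).

Definition Omega_plus : form2 X := fun x u v =>
  2^-1 * \sum_p \sum_q omega_at x p q * wedge2 (dz p) (dz q) u v.

Definition Omega_I : form2 X := fun x u v =>
  (2 * 'i)^-1 * - \sum_p \sum_q omega_at x p q * wedge2 (dz p) (dth q) u v.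

Definition Omega_minus : form2 X := fun x u v =>
  let P := joyce_potential J (tb_proj x) in
  let W := lp_W P in
  let y := tb_map (lp_chart P) x in
  let u' := tcoord (tb_chart (lp_chart P) : chart K X (n + n)) x u in
  let v' := tcoord (tb_chart (lp_chart P) : chart K X (n + n)) x v in
  2^-1 * (\sum_p \sum_q lp_omega P p q * wedge2 (dth p) (dth q) u' v') +
  \sum_p \sum_q D2 W (eth p) (eth q) y * wedge2 (dth p) (dz q) u' v' +
  \sum_p \sum_q D2 W (ez p) (eth q) y * wedge2 (dz p) (dz q) u' v'.

Definition Theta_I : form1 X := interior_product (euler_tb M) Omega_I.

(* The pullback to X of the symplectic form of the twistor fibre over eps. *)
Definition twistor_form (eps : option K) : form2 X := fun x u v =>
  if eps is Some e then
    e ^- 2 * Omega_plus x u v + 2 * 'i * e^-1 * Omega_I x u v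
      + Omega_minus x u v
  else Omega_minus x u v.

(* The twistor fibre Z_eps with the quotient map [q] and the symplectic form
   [Omega]. *)
Record twistor_fibre (eps : option K) (Z : complexManifold K n) (q : X -> Z)
    (Omega : form2 Z) : Prop := {
  twistor_leaves : leaf_space (im_h_eps eps) n q;
  twistor_symplectic : symplectic_form Omega;
  twistor_pullback : pull2 q Omega = twistor_form eps }.

(* E generates C^*-actions on X and M. *)
Definition homogeneous_joyce (actX : K -> X -> X) (actM : K -> M -> M) : Prop :=
  Cstar_action actX (euler_tb M) /\ Cstar_action actM (euler M).

End Structure.

(* An open embedding of M in T_B^*, given by the projection [rho] to B and the
   tautological section [beta], with [beta m] a linear form on T_{rho(m)} B;
   [cot_map t] is the embedding in the canonical co-ordinates (t, s) on T_B^*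
   induced by a chart [t] of B. *)
Definition cot_map n d (M : complexManifold K n) (B : complexManifold K d)
    (rho : M -> B) (beta : M -> 'rV[K]_d -> K) (t : chart K B d) (m : M) :
    'rV[K]_(d + d) :=
  row_mx (t (rho m)) (\row_i beta m (tvec t (t (rho m)) (e_ i))).

Record cotangent_structure d (M : complexManifold K (d + d)) (omega : form2 M)
    (B : complexManifold K d) (rho : M -> B) (beta : M -> 'rV[K]_d -> K) :
    Prop := {
  cot_linear : forall m, linear (beta m);
  cot_inj : forall m m', rho m = rho m' -> beta m = beta m' -> m = m';
  cot_continuous : continuous rho;
  cot_holo : forall (t : chart K B d) m, atlas t -> chart_dom t (rho m) ->
    differentiable (cot_map rho beta t \o chart_inv (chart_at m)) (chart_at m m);
  cot_immersion : forall (t : chart K B d) m, atlas t -> chart_dom t (rho m) ->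
    injective ('d (cot_map rho beta t \o chart_inv (chart_at m)) (chart_at m m));
  cot_open : forall (t : chart K B d) (U : set M), atlas t -> open U ->
    U `<=` rho @^-1` chart_dom t -> open (cot_map rho beta t @` U);
  cot_canonical : forall (t : chart K B d) m u v,
    atlas t -> chart_dom t (rho m) ->
    let dF := 'd (cot_map rho beta t \o chart_inv (chart_at m)) (chart_at m m) in
    omega m u v = \sum_i wedge2 (dz i) (dth i) (dF u) (dF v) }.

Definition liouville n d (M : complexManifold K n) (B : complexManifold K d)
    (rho : M -> B) (beta : M -> 'rV[K]_d -> K) : form1 M :=
  fun m u => beta m (mdiff rho m u).

Section Systems.
Variables (d : nat) (M : periodManifold K (d + d)) (J : joyceStructure M).
Local Notation X := (tangentManifold M).
Variables (B : complexManifold K d) (rho : M -> B).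
Variables (Y : complexManifold K (d + d + d)) (i : Y -> X).

Definition base_map (y : Y) : B := rho (tb_proj (i y)).

(* For each b in B, the restriction of q_1 to f^-1(b) is etale; [F] is
   f^-1(b) as a complex manifold. *)
Definition transversality (Z1 : complexManifold K (d + d)) (q1 : X -> Z1) :
    Prop :=
  forall b : B, exists (F : complexManifold K (d + d)) (e : F -> Y),
    [/\ embedding e, range e = base_map @^-1` [set b] & etale (q1 \o i \o e)].

(* The time-dependent Hamiltonian system associated to the Joyce structure, the
   cotangent bundle structure and the Lagrangian submanifold. *)
Record associated_system (beta : M -> 'rV[K]_d -> K) (H : hamSystem base_map) :
    Prop := {
  assoc_strong : strongly_integrable H;
  assoc_form : forall y u v, vertical base_map y u -> vertical base_map y v ->
    ham_form H y u v = 2 * 'i * pull2 i (Omega_I J) y u v;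
  assoc_conn : forall eps y, eps != 0 ->
    im_k_eps H eps y = mdiff i y @^-1` im_h_eps J (Some eps) (i y);
  assoc_varpi : forall y, ham_varpi H y = beta (tb_proj (i y)) }.

(* [tau], defined on the open set [V], is the tau-function on Y for the
   potentials [Theta0] on Z_0 = M and [Theta1] on the open set [V1] of Z_1. *)
Record joyce_tau_function (Z1 : complexManifold K (d + d)) (q1 : X -> Z1)
    (Omega1 : form2 Z1) (Theta0 : form1 M) (V1 : set Z1) (Theta1 : form1 Z1)
    (V : set Y) (tau : Y -> K) : Prop := {
  jtau_open1 : open V1;
  jtau_holo1 : holo_form1 V1 Theta1;
  jtau_ext1 : forall z u v, V1 z -> ext_d1 Theta1 z u v = Omega1 z u v;
  jtau_holo0 : holo_form1 setT Theta0;
  jtau_ext0 : ext_d1 Theta0 = joyce_omega J;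
  jtau_lie0 : forall m v, lie_deriv1 (euler M) Theta0 m v = 2 * Theta0 m v;
  jtau_open : open V;
  jtau_sub : V `<=` (q1 \o i) @^-1` V1;
  jtau_neq0 : forall y, V y -> tau y != 0;
  jtau_holo : holo_fun V tau;
  jtau_dlog : forall y v, V y ->
    dlog tau y v =
    pull1 i (fun x w => pull1 tb_proj Theta0 x w + 2 * 'i * Theta_I J x w
                        - pull1 q1 Theta1 x w) y v }.

End Systems.
End Joyce.

Definition two_pi_i (R : realType) : R[i] := 2 * (pi : R)%:C * 'i.

(* Main.v *)
Require Import Defs.
From HB Require Import structures.
From mathcomp Require Import all_boot all_order all_algebra.
From mathcomp Require Import complex.
From mathcomp Require Import all_classical all_reals all_analysis.

Set Implicit Arguments.
Unset Strict Implicit.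
Unset Printing Implicit Defensive.

Import Order.TTheory GRing.Theory Num.Theory.
Import numFieldNormedType.Exports.

Local Open Scope classical_set_scope.
Local Open Scope ring_scope.
Local Open Scope complex_scope.

(** Let [u] be a tangent vector to [X = T_M] that comes from the leaf [L], and
let [E] be the Euler field of [X].  By the definition of the tau-function,
[d log tau] takes on [u] the value
<<
  omega(E, pi_* u) + lambda(pi_* u) + 2i Theta_I(u) - Theta_1(q_1* u),
>>
so it has to be shown that the first and third terms cancel and that the last
one is zero.

Leaves of [k_1] are tangent to [im(h_1)], and [q_1] contracts the leaves of that
distribution, so [q_1* u = 0] ([leaf_space_mdiff0]).  This kills the last term;
it also shows that [q_1^* Omega_1 = Omega_+ + 2i Omega_I + Omega_-] vanishes on
the pair [(E, u)].  Since [Omega_+ = pi^* omega] ([Omega_plusE]), what remains is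
<<
  omega(E, pi_* u) + 2i Theta_I(u) = - Omega_-(E, u)     (euler_contraction).
>>
Now [Omega_- = q_inf^* Omega_inf], and both [E] and [u] are mapped by [q_inf] to
vectors tangent to the Lagrangian submanifold [R]: for [u] this is because [u]
is tangent to [Y = q_inf^-1(R)], for [E] because [R] is invariant under the
action that [E] generates.  Hence [Omega_-(E, u) = 0]
([Omega_minus_isotropic]).

The analytic input is that a map into the ambient manifold with values in an
embedded submanifold has its differential in the tangent space of the
submanifold ([diff_embedding_range]).  It rests on [differentiable_lift], which
replaces the inverse function theorem: the map factors through the submanifold
by a continuous map, and the lift is differentiable because a linear left
inverse of the differential of the embedding makes it so. *)

(** * Differentiability of continuous lifts *)

Lemma diff_near_le (K : numFieldType) (V W : normedModType K) (f : V -> W)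
    (x : V) (e : K) : differentiable f x -> 0 < e ->
  \forall y \near x, `|f y - f x - 'd f x (y - x)| <= e * `|y - x|.
Proof.
move=> /diff_locallyP[_ /eqaddoP fE] e0.
rewrite (near_shift 0 x) /=; near=> h => /=.
rewrite !subr0 addrK; have -> : f (h + x) - f x - 'd f x h =
  (f \o shift x - (cst (f x) + 'd f x)) h by rewrite !fctE /= opprD addrA.
by near: h; exact: fE.
Unshelve. all: by end_near. Qed.

Lemma near_le_differentiable (K : numFieldType) (V W : normedModType K)
    (f : V -> W) (L : {linear V -> W}) (x : V) : continuous L ->
  (forall e : K, 0 < e ->
    \forall y \near x, `|f y - f x - L (y - x)| <= e * `|y - x|) ->
  differentiable f x.
Proof.
move=> cL fL.
have fE : f \o shift x = cst (f x) + L +o_ 0 id.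
  apply/eqaddoP => e /fL; rewrite (near_shift 0 x) /=.
  by apply: filterS => h /=; rewrite subr0 addrK !fctE /= opprD addrA.
have dfE := diff_unique cL fE.
by apply/diff_locallyP; rewrite dfE.
Qed.

(** With [k] small, the expansions of [F] at [g v] and of [F \o g] at [v] give
[|dg - l| <= k |dg| + k |y - v|], where [dg = g y - g v] and
[l = 'd (F \o g) v (y - v)].  As [l] is at most [C |y - v|], this first bounds
[dg] by a multiple of [|y - v|], and then shows that [l] is the differential of
[g]. *)
Lemma differentiable_lift (K : numFieldType) (U V : normedModType K)
    (F : U -> U) (g : V -> U) (v : V) :
  {for v, continuous g} -> differentiable F (g v) ->
  'd F (g v) = id :> (U -> U) -> differentiable (F \o g) v ->
  differentiable g v.
Proof.
move=> cg dF dFid dFg.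
have [C C0 LC] := linear_lipschitz (diff_continuous dFg).
apply: (near_le_differentiable (diff_continuous dFg)) => e e0.
(* The constant is chosen so that k <= 1/2 and k (2 + 2 C) <= e. *)
pose k := e / (2 * (1 + C) + 2 * e).
have C1 : 0 < 1 + C by rewrite addr_gt0.
have D0 : 0 < 2 * (1 + C) + 2 * e by rewrite addr_gt0 ?mulr_gt0.
have k0 : 0 < k by rewrite divr_gt0.
have k_half : k + k <= 1.
  rewrite -mulrDl ler_pdivrMr// mul1r -{1}[e]mul1r -{2}[e]mul1r.
  by rewrite -mulrDl lerDr mulr_ge0 ?ltW.
have k_e : k * (2 * (1 + C)) <= e.
  by rewrite mulrAC ler_pdivrMr// ler_pM2l// lerDl mulr_ge0 ?ltW.
have FL : \forall y \near v,
    `|F (g y) - F (g v) - (g y - g v)| <= k * `|g y - g v|.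
  by have := cg _ (diff_near_le dF k0); rewrite dFid.
have FgL := diff_near_le dFg k0.
near=> y.
have : `|F (g y) - F (g v) - (g y - g v)| <= k * `|g y - g v|.
  by near: y.
have : `|F (g y) - F (g v) - 'd (F \o g) v (y - v)| <= k * `|y - v|.
  by near: y.
set a := F _ - _; set l := 'd _ _ _; set dg := g y - g v => al ag.
have gl : `|dg - l| <= k * `|dg| + k * `|y - v|.
  have -> : dg - l = (a - l) - (a - dg) by rewrite opprB [RHS]addrC addrA subrK.
  by rewrite [leRHS]addrC (le_trans (ler_normB _ _))// lerD.
have dg_le : `|dg| <= k * `|dg| + (k + C) * `|y - v|.
  have := ler_normD (dg - l) l; rewrite subrK => /le_trans; apply.
  by rewrite mulrDl addrA lerD// LC.
(* Twice [dg_le], with [k + k <= 1] used to absorb one copy of [|dg|]. *)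
have dg_le2 : `|dg| <= 2 * (k + C) * `|y - v|.
  rewrite -(lerD2l `|dg|) -{1 2}[`|dg|]mul1r -mulrDl -mulrA.
  have -> : 1 + 1 = 2 :> K by [].
  rewrite (le_trans (ler_wpM2l (ler0n K 2) dg_le))// mulrDr lerD2r mulrA.
  by rewrite ler_piMl// mulrDl !mul1r.
rewrite (le_trans gl)// -mulrDr.
have : `|dg| + `|y - v| <= 2 * (1 + C) * `|y - v|.
  rewrite (le_trans (lerD dg_le2 (lexx _)))// -{2}[`|y - v|]mul1r -mulrDl.
  rewrite ler_wpM2r// !mulrDr addrAC lerD2r mulr1 lerD2r.
  by rewrite mulrDl !mul1r.
move=> /(ler_wpM2l (ltW k0)) /le_trans; apply.
by rewrite mulrA ler_wpM2r.
Unshelve. all: by end_near.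
Qed.

(** If [J \o s] is differentiable and [J] is immersive at [s v], then a merely
continuous [s] is differentiable, by [differentiable_lift] applied to [J]
followed by a left inverse of its differential; the claim is then the chain
rule. *)
Lemma diff_factor_range (K : numFieldType) (V : normedModType K) (m n : nat)
    (J : 'rV[K]_m -> 'rV[K]_n) (g : V -> 'rV[K]_n) (s : V -> 'rV[K]_m)
    (v u : V) :
  differentiable J (s v) -> injective ('d J (s v)) -> differentiable g v ->
  {for v, continuous s} -> (\forall y \near v, J (s y) = g y) ->
  exists w, 'd g v u = 'd J (s v) w.
Proof.
move=> dJ iJ dg cs Jsg.
(* [pinvmx A] inverts the differential of [J] from the left. *)
pose A := lin1_mx ('d J (s v)).
have free : row_free A.
  rewrite -kermx_eq0; apply/rowV0P => w /sub_kermxP.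
  by rewrite mul_rV_lin1 => Aw; apply: iJ; rewrite Aw linear0.
have lin := @continuous_mulmxr K n m (pinvmx A).
have dP y := @linear_differentiable K _ _ (mulmxr (pinvmx A)) y lin.
have dFv : differentiable (mulmxr (pinvmx A) \o J) (s v).
  exact: differentiable_comp.
have ds : differentiable s v.
  apply: (differentiable_lift cs dFv).
    rewrite diff_comp// diff_lin//; apply/funext => w /=.
    by rewrite -(mul_rV_lin1 ('d J (s v))) -mulmxA mulmxVp ?mulmx1.
  have Pg : differentiable (mulmxr (pinvmx A) \o g) v.
    exact: differentiable_comp.
  have nPg : \forall y \near v,
      (mulmxr (pinvmx A) \o g) y = ((mulmxr (pinvmx A) \o J) \o s) y.
    by apply: filterS Jsg => y /= ->.
  by have [] := near_eq_is_diff nPg Pg.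
have [_ E] := near_eq_is_diff Jsg (differentiable_comp ds dJ).
by exists ('d s v u); rewrite E diff_comp.
Qed.

(** * Differentials on complex manifolds *)

Section ChainRule.
Variable K : numClosedFieldType.

(** The chain rule at a point of a manifold, for maps from any normed space: it is
used for charts of a manifold and for curves parametrised by [K].  The point
[x] is kept apart from [phi v], which in these uses equals it only
propositionally. *)
Lemma diff_through_chart (V W : normedModType K) n (M : complexManifold K n)
    (c := @chart_at K n M) (phi : V -> M) (g : M -> W) (v : V) (x : M) :
  phi v = x -> {for v, continuous phi} -> differentiable (c x \o phi) v ->
  differentiable (g \o chart_inv (c x)) (c x x) ->
  differentiable (g \o phi) v /\
  forall u, 'd (g \o phi) v u =
    'd (g \o chart_inv (c x)) (c x x) ('d (c x \o phi) v u).
Proof.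
move=> phiv cphi dphi dg.
have [ocx _ cK _ _] := atlas_chart (chart_at_atlas x).
have nE : \forall y \near v,
    ((g \o chart_inv (c x)) \o (c x \o phi)) y = (g \o phi) y.
  have : \forall y \near v, chart_dom (c x) (phi y).
    apply: cphi; rewrite phiv; apply: open_nbhs_nbhs; split => //.
    exact: chart_at_dom.
  by apply: filterS => y dy /=; rewrite /c cK.
have E : (c x \o phi) v = c x x by rewrite /= phiv.
have dg' : differentiable (g \o chart_inv (c x)) ((c x \o phi) v) by rewrite E.
have [? dE] := near_eq_is_diff nE (differentiable_comp dphi dg').
split => // u; apply: etrans (congr1 (@^~ u) dE) _.
apply: etrans (congr1 (@^~ u) (diff_comp dphi dg')) _.
exact: (congr1 (fun p => 'd (g \o chart_inv (c x)) p ('d (c x \o phi) v u)) E).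
Qed.

Lemma chart_at_invK n (M : complexManifold K n) (x : M) :
  chart_inv (chart_at x) (chart_at x x) = x.
Proof.
have [_ _ cK _ _] := atlas_chart (chart_at_atlas x).
exact: cK (chart_at_dom x).
Qed.

Lemma continuous_chart_at_inv m n (M : complexManifold K m)
    (N : complexManifold K n) (f : M -> N) (x : M) :
  {for x, continuous f} ->
  {for chart_at x x, continuous (f \o chart_inv (chart_at x))}.
Proof.
move=> cf.
have [_ _ _ _ cinv] := atlas_chart (chart_at_atlas x).
apply: continuous_comp; first exact: cinv (chart_at_dom x).
by rewrite chart_at_invK.
Qed.

Lemma holomorphic_at_comp m n p (M : complexManifold K m)
    (N : complexManifold K n) (P : complexManifold K p) (f : M -> N)
    (g : N -> P) (x : M) : holomorphic_at f x -> holomorphic_at g (f x) ->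
  holomorphic_at (g \o f) x.
Proof.
move=> [cf df] [cg dg]; split; first exact: continuous_comp.
have [|dgf _] := diff_through_chart _ (continuous_chart_at_inv cf) df dg.
  by rewrite /= chart_at_invK.
exact: dgf.
Qed.

Lemma mdiff_comp m n p (M : complexManifold K m)
    (N : complexManifold K n) (P : complexManifold K p) (f : M -> N)
    (g : N -> P) (x : M) (v : 'rV[K]_m) :
  holomorphic_at f x -> holomorphic_at g (f x) ->
  mdiff (g \o f) x v = mdiff g (f x) (mdiff f x v).
Proof.
move=> [cf df] [cg dg].
have [|_ E] := diff_through_chart _ (continuous_chart_at_inv cf) df dg.
  by rewrite /= chart_at_invK.
exact: E.
Qed.

Lemma fdiff_comp m n (M : complexManifold K m) (N : complexManifold K n)
    (f : M -> N) (g : N -> K) (x : M) (v : 'rV[K]_m) :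
  holomorphic_at f x ->
  differentiable (g \o chart_inv (chart_at (f x))) (chart_at (f x) (f x)) ->
  fdiff (g \o f) x v = fdiff g (f x) (mdiff f x v).
Proof.
move=> [cf df] dg.
have [|_ E] := diff_through_chart _ (continuous_chart_at_inv cf) df dg.
  by rewrite /= chart_at_invK.
exact: E.
Qed.

(** A vector of the distribution is tangent to the leaf through its base point, and
[q] is constant on that leaf. *)
Lemma leaf_space_mdiff0 n k m (M : complexManifold K n)
    (D : M -> set 'rV[K]_n) (Z : complexManifold K m) (q : M -> Z) (x : M)
    (w : 'rV[K]_n) : leaf_space D k q -> D x w -> mdiff q x w = 0.
Proof.
move=> [[hq _] _ leaf].
have [L [l [[[_ _ [hl _] _ lD] _] lq]]] := leaf (q x).
have [y _ <-] : range l x by rewrite lq.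
rewrite -(lD y) => -[v _ <-].
rewrite -mdiff_comp// /mdiff.
have -> : q \o l = cst (q (l y)).
  apply/funext => t /=.
  have : range l (l t) by exists t.
  have : range l (l y) by exists y.
  by rewrite lq /= => -> ->.
have -> : chart_at (cst (q (l y)) y) \o cst (q (l y)) \o
  chart_inv (chart_at y) = cst (chart_at (q (l y)) (q (l y))) by [].
by rewrite diff_cst.
Qed.

(** The map [phi] lifts to [L] near [v] since [j] is injective, and the lift is
continuous at [v] since the topology of [L] is induced by that of [N]; the
statement is then [diff_factor_range] in charts. *)
Lemma diff_embedding_range (V : normedModType K) m n (L : complexManifold K m)
    (N : complexManifold K n) (j : L -> N) (phi : V -> N) (v u : V) (s : L) :
  embedding j -> phi v = j s -> {for v, continuous phi} ->
  differentiable (chart_at (j s) \o phi) v ->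
  (\forall y \near v, range j (phi y)) ->
  exists w, 'd (chart_at (j s) \o phi) v u = mdiff j s w.
Proof.
move=> [[hj ij] injj openj] phiv cphi dphi nphi.
pose sig y := xget s [set t | j t = phi y].
have jsig y : range j (phi y) -> j (sig y) = phi y.
  by move=> [t _ jt]; rewrite /sig; case: xgetP => [? -> //|/(_ t)/=].
have sigv : sig v = s by apply: injj; rewrite jsig//; exists s.
have csig : {for v, continuous sig}.
  move=> O; rewrite nbhsE /= sigv => -[U [oU Us] UO].
  have [W oW UW] := openj U oU.
  have : \forall y \near v, W (phi y).
    apply: cphi; rewrite phiv; apply: open_nbhs_nbhs; split => //.
    by move: Us; rewrite UW.
  move=> nW; apply: filterS2 nW nphi => y Wy jy /=.
  by apply: UO; rewrite UW /= jsig.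
have [ocs _ csK ccs _] := atlas_chart (chart_at_atlas s).
have cE : (chart_at s \o sig) v = chart_at s s by rewrite /= sigv.
have [_ dj] := hj s.
have := @diff_factor_range K V m n
  (chart_at (j s) \o j \o chart_inv (chart_at s)) (chart_at (j s) \o phi)
  (chart_at s \o sig) v u.
rewrite cE; apply; [exact: dj | exact: ij | exact: dphi | |].
  apply: (continuous_comp csig); rewrite sigv; exact: ccs (chart_at_dom s).
have nd : \forall y \near v, chart_dom (chart_at s) (sig y).
  apply: csig; rewrite sigv; apply: open_nbhs_nbhs; split => //.
  exact: chart_at_dom.
near=> y; rewrite /= csK ?jsig//; first by near: y.
by near: y.
Unshelve. all: by end_near. Qed.

Lemma mdiff_embedding_range p m n (P : complexManifold K p)
    (L : complexManifold K m) (N : complexManifold K n) (j : L -> N)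
    (f : P -> N) (y : P) (s : L) (u : 'rV[K]_p) :
  embedding j -> holomorphic_at f y -> (forall y', range j (f y')) ->
  f y = j s -> exists w, mdiff f y u = mdiff j s w.
Proof.
move=> ej [cf df] fj fy; rewrite /mdiff fy; apply: diff_embedding_range => //.
- by rewrite /= chart_at_invK.
- exact: continuous_chart_at_inv.
- by rewrite -fy.
- by near=> z; exact: fj.
Unshelve. all: by end_near. Qed.

(** The vector [E x] is the velocity at [a = 1] of the orbit [a |-> act a x], whose
image under [q] stays in the submanifold. *)
Lemma mdiff_orbit_range m n p (M : complexManifold K m)
    (L : complexManifold K p) (N : complexManifold K n) (j : L -> N)
    (q : M -> N) (act : K -> M -> M) (E : vfield M) (x : M) (s : L) :
  embedding j -> Cstar_action act E -> holomorphic_at q x -> q x = j s ->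
  (forall a, a != 0 -> range j (q (act a x))) ->
  exists w, mdiff q x (E x) = mdiff j s w.
Proof.
move=> ej Eact hq qx qj; have [cq dq] := hq.
have n10 : (1 : K) != 0 by exact: oner_neq0.
have orb1 := act1 Eact x.
pose phi (a : K) := act a x.
have cphi : {for 1, continuous phi}.
  have pc : {for (1 : K), continuous (fun a : K => (a, x))}.
    exact: (@cvg_pair K K M (nbhs (1 : K)) (nbhs (1 : K)) (nbhs x) _ _ _ id
      (cst x) cvg_id (cvg_cst _)).
  exact: (continuous_comp pc (act_continuous Eact n10)).
have dphi : differentiable (chart_at x \o phi) (1 : K).
  have pd : differentiable (fun a : K => (a, chart_at x x)) (1 : K).
    by apply: differentiable_pair.
  have := differentiable_comp pd (act_holomorphic Eact x n10).
  by rewrite orb1 /comp/= chart_at_invK.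
have [dqphi dE] := diff_through_chart orb1 cphi dphi dq.
have -> : E x = 'd (chart_at x \o phi) (1 : K) 1.
  by rewrite -deriveE// -(act_generated Eact).
rewrite /mdiff -dE.
rewrite qx in dqphi *; apply: (diff_embedding_range (phi := q \o phi)) => //.
- by rewrite /phi/= orb1.
- by apply: continuous_comp => //; rewrite /phi orb1.
near=> a; apply: qj; near: a.
apply/nbhs_ballP; exists 1 => //= b; apply: contraTneq => ->.
by rewrite /ball /= subr0 normr1 ltxx.
Unshelve. all: by end_near. Qed.

End ChainRule.

(** * The closed forms of a Joyce structure *)

Section JoyceForms.
Variable K : numClosedFieldType.

Lemma linear_fun0 (V W : lmodType K) (f : V -> W) : linear f -> f 0 = 0.
Proof. by move=> /(_ (-1) 0 0); rewrite scaler0 addr0 scaleN1r addNr. Qed.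

Lemma linear_coordE n (f : 'rV[K]_n -> K) (u : 'rV[K]_n) : linear f ->
  f u = \sum_p u 0 p * f (e_ K p).
Proof.
move=> lf; pose F : {linear 'rV[K]_n -> K} :=
  HB.pack f (GRing.isLinear.Build _ _ _ _ f lf).
rewrite {1}(row_sum_delta u) -[f _]/(F _) linear_sum.
by apply: eq_bigr => p _; rewrite linearZ.
Qed.

Variables (tpi : K) (n : nat) (M : periodManifold K n).
Local Notation X := (tangentManifold M).

(** In the induced co-ordinates (z, theta), the projection of the tangent bundle is
[(z, theta) |-> z]. *)
Lemma tb_proj_near (x : X) : \forall z \near chart_at x x, lsubmx z =
  (chart_at (tb_proj x) \o tb_proj \o chart_inv (chart_at x)) z.
Proof.
have [oc oic cK _ _] := atlas_chart (chart_at_atlas (tb_proj x)).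
have : \forall z \near chart_at x x,
    (chart_at (tb_proj x) @` chart_dom (chart_at (tb_proj x))) (lsubmx z).
  have cl := @continuous_lsubmx K 1 n n (chart_at x x).
  apply: cl; apply: open_nbhs_nbhs; split => //.
  exists (tb_proj x); first exact: chart_at_dom.
  by rewrite row_mxKl.
by apply: filterS => z [m dm mz] /=; rewrite -mz cK.
Qed.

Lemma tb_proj_holomorphic : holomorphic (@tb_proj K n M).
Proof.
move=> x; split.
  move=> O; rewrite nbhsE => -[U [oU Ux] UO].
  rewrite /= nbhsE; exists [set x' : X | U x'.1]; last by move=> y /UO.
  by split => //; exact: (open_tb_dom (chart_at x.1) oU).
have cl := @continuous_lsubmx K 1 n n.
by have [] := near_eq_is_diff (tb_proj_near x)
  (@linear_differentiable K _ _ lsubmx (chart_at x x) cl).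
Qed.

Lemma mdiff_tb_proj (x : X) (u : 'rV[K]_(n + n)) :
  mdiff tb_proj x u = lsubmx u.
Proof.
have cl := @continuous_lsubmx K 1 n n.
have [_ E] := near_eq_is_diff (tb_proj_near x)
  (@linear_differentiable K _ _ lsubmx (chart_at x x) cl).
apply: etrans (congr1 (@^~ u) E) _.
exact: (congr1 (@^~ u) (@diff_lin K _ _ lsubmx (chart_at x x) cl)).
Qed.

Variable J : joyceStructure tpi M.

(** This is [Omega_+ = pi^* omega].  The double sum antisymmetrises [omega], which
is already skew, and so counts it twice; the factor [1/2] compensates. *)
Lemma Omega_plusE (x : X) (u v : 'rV[K]_(n + n)) :
  Omega_plus J x u v = joyce_omega J (tb_proj x) (lsubmx u) (lsubmx v).
Proof.
have [hol _ _] := joyce_symplectic J.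
have [lr ll alt _] := hol (tb_proj x) I.
set om := joyce_omega J (tb_proj x) in lr ll alt *.
have om0l a : om 0 a = 0 by exact: linear_fun0 (ll a).
have bil a b : om a b = \sum_p \sum_q om (e_ K p) (e_ K q) * (a 0 p * b 0 q).
  rewrite (linear_coordE a (ll b)); apply: eq_bigr => p _.
  rewrite (linear_coordE b (lr _)) mulr_sumr; apply: eq_bigr => q _.
  by rewrite mulrA mulrC.
have skew a b : om b a = - om a b.
  have addl c d e : om (c + d) e = om c e + om d e.
    by have := ll e 1 c d; rewrite !scale1r.
  have addr c d e : om c (d + e) = om c d + om c e.
    by have := lr c 1 d e; rewrite !scale1r.
  have := alt (b + a); rewrite addl !addr !alt add0r addr0 => /eqP.
  by rewrite addr_eq0 => /eqP.
rewrite /Omega_plus.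
have -> : \sum_p \sum_q omega_at J x p q * wedge2 (dz p) (dz q) u v =
    om (lsubmx u) (lsubmx v) - om (lsubmx v) (lsubmx u).
  rewrite !bil -sumrB; apply: eq_bigr => p _; rewrite -sumrB.
  by apply: eq_bigr => q _; rewrite -mulrBr /wedge2 /dz !mxE.
rewrite (skew (lsubmx u)) opprK -[X in _ * X]mulr2n -[X in _ * X]mulr_natl.
by rewrite mulKf// pnatr_eq0.
Qed.

End JoyceForms.

(** * Contraction with the Euler vector field *)

Section Contraction.
Variables (K : numClosedFieldType) (tpi : K).

(** The twistor form at [1] is pulled back along [q], which kills [u]; contracting it
with the Euler field gives [i_E Omega_+ + 2i Theta_I + i_E Omega_-], evaluated
on [u]. *)
Lemma euler_contraction n (M : periodManifold K n) (J : joyceStructure tpi M)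
    (Z : complexManifold K n) (q : tangentManifold M -> Z) (Om : form2 Z)
    (x : tangentManifold M) (u : 'rV[K]_(n + n)) :
  twistor_fibre J (Some 1) q Om -> im_h_eps J (Some 1) x u ->
  Omega_minus J x (euler_tb M x) u = 0 ->
  interior_product (euler M) (joyce_omega J) (tb_proj x) (mdiff tb_proj x u) +
    2 * 'i * Theta_I J x u = 0.
Proof.
move=> [leaves [hol _ _] pull] hu minus0.
have [lr _ _ _] := hol (q x) I.
have := congr1 (fun F => F x (euler_tb M x) u) pull.
rewrite /pull2 (leaf_space_mdiff0 leaves hu) (linear_fun0 (lr _)).
rewrite /twistor_form minus0 addr0 expr1n invr1 mul1r mulr1 Omega_plusE.
by rewrite /euler_tb row_mxKl mdiff_tb_proj => /esym.
Qed.

(** Here [i] parametrises a submanifold inside the preimage of an invariant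
Lagrangian [j]: both the Euler field and [mdiff i y w] project to tangent
vectors of the Lagrangian, on which [Om] vanishes. *)
Lemma Omega_minus_isotropic n p m (M : periodManifold K n)
    (J : joyceStructure tpi M)
    (actX : K -> tangentManifold M -> tangentManifold M)
    (Z : complexManifold K n) (q : tangentManifold M -> Z) (Om : form2 Z)
    (actZ : K -> Z -> Z) (L : complexManifold K p) (j : L -> Z)
    (Y : complexManifold K m) (i : Y -> tangentManifold M) (y : Y)
    (w : 'rV[K]_m) :
  Cstar_action actX (euler_tb M) -> twistor_fibre J None q Om ->
  (forall a x, a != 0 -> actZ a (q x) = q (actX a x)) ->
  embedding j -> (forall s u v, pull2 j Om s u v = 0) ->
  (forall a, a != 0 -> actZ a @` range j `<=` range j) ->
  holomorphic i -> (forall y, range j (q (i y))) ->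
  Omega_minus J (i y) (euler_tb M (i y)) (mdiff i y w) = 0.
Proof.
move=> Eact [[[hq _] _ _] _ pull] actZE ej lag inv hi qij.
have [s _ js] := qij y.
have [e Ee] : exists e, mdiff q (i y) (euler_tb M (i y)) = mdiff j s e.
  apply: (mdiff_orbit_range ej Eact) => // a a0.
  by rewrite -actZE// -js; apply: (inv a a0); exists (j s) => //; exists s.
have [w' Ew] : exists w', mdiff (q \o i) y w = mdiff j s w'.
  by apply: mdiff_embedding_range => //; exact: holomorphic_at_comp.
rewrite -[LHS]/(twistor_form J None _ _ _) -pull /pull2 -mdiff_comp//.
by rewrite Ee Ew /= -js; exact: lag.
Qed.

End Contraction.

(** * The tau-function on leaves *)

(** In a canonical chart, [rho] is the base component of the embedding into the
cotangent bundle. *)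
Lemma cotangent_proj_holomorphic (K : numClosedFieldType) d
    (M : complexManifold K (d + d)) (omega : form2 M) (B : complexManifold K d)
    (rho : M -> B) (beta : M -> 'rV[K]_d -> K) :
  cotangent_structure omega rho beta -> holomorphic rho.
Proof.
move=> cot m; split; first exact: (cot_continuous cot).
have dF := cot_holo cot (chart_at_atlas (rho m)) (chart_at_dom (rho m)).
have cl := @continuous_lsubmx K 1 d d.
have := differentiable_comp dF (@linear_differentiable K _ _ lsubmx _ cl).
set f := lsubmx \o _; have -> // : f =
  chart_at (rho m) \o rho \o chart_inv (chart_at m).
by apply/funext => z; rewrite /f /= row_mxKl.
Qed.

Theorem mainTheorem4 (R : realType) (d : nat)
  (* the complex manifold M with its period structure, and the Joyce structure *)
  (M : periodManifold R[i] (d + d))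
  (M_hausdorff : hausdorff_space M) (M_countable : @second_countable M)
  (J : joyceStructure (two_pi_i R) M)
  (actX : R[i] -> tangentManifold M -> tangentManifold M)
  (actM : R[i] -> M -> M)
  (J_homogeneous : homogeneous_joyce actX actM)
  (* the twistor fibres over 1 and infinity *)
  (Z1 Zinf : complexManifold R[i] (d + d))
  (q1 : tangentManifold M -> Z1) (qinf : tangentManifold M -> Zinf)
  (Omega1 : form2 Z1) (Omega_inf : form2 Zinf)
  (fibre1 : twistor_fibre J (Some 1) q1 Omega1)
  (fibre_inf : twistor_fibre J None qinf Omega_inf)
  (* the induced action on the twistor fibre over infinity *)
  (actZ : R[i] -> Zinf -> Zinf)
  (actZE : forall (a : R[i]) x, a != 0 -> actZ a (qinf x) = qinf (actX a x))
  (* the cotangent bundle structure *)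
  (B : complexManifold R[i] d)
  (B_hausdorff : hausdorff_space B) (B_countable : @second_countable B)
  (rho : M -> B) (beta : M -> 'rV[R[i]]_d -> R[i])
  (cot : cotangent_structure (joyce_omega J) rho beta)
  (cot_lie : forall m v,
     lie_deriv1 (euler M) (liouville rho beta) m v =
     2 * liouville rho beta m v)
  (* the invariant Lagrangian submanifold j : Lag -> Zinf, and i : Y -> X *)
  (Lag : complexManifold R[i] d) (j : Lag -> Zinf)
  (j_embedding : embedding j)
  (j_lagrangian : forall s u v, pull2 j Omega_inf s u v = 0)
  (j_invariant : forall a : R[i], a != 0 -> actZ a @` range j `<=` range j)
  (Y : complexManifold R[i] (d + d + d)) (i : Y -> tangentManifold M)
  (i_embedding : embedding i) (i_range : range i = qinf @^-1` range j)
  (star : transversality rho i q1)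
  (* the associated Hamiltonian system on f : Y -> B *)
  (H : hamSystem (base_map rho i))
  (H_assoc : associated_system J beta H)
  (* the tau-function on Y for the potential i_E(Omega_0) + lambda *)
  (V1 : set Z1) (Theta1 : form1 Z1) (V : set Y) (tau : Y -> R[i])
  (tau_joyce : joyce_tau_function J i q1 Omega1
     (fun m v => interior_product (euler M) (joyce_omega J) m v
                 + liouville rho beta m v)
     V1 Theta1 V tau) :
  (forall (L : complexManifold R[i] d) (l : L -> Y),
     is_leaf (im_k_eps H 1) l ->
     forall x v, V (l x) ->
     dlog (tau \o l) x v =
     pull1 l (pull1 (tb_proj \o i) (liouville rho beta)) x v) /\
  ham_tau_function H V tau.
Proof.
have [Xact _] := J_homogeneous.
have [[hi _] _ _] := i_embedding.
have qij y : range j (qinf (i y)).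
  have : range i (i y) by exists y.
  by rewrite i_range.
have hrho := cotangent_proj_holomorphic cot.
have hp : holomorphic (tb_proj \o i).
  by move=> y; apply: holomorphic_at_comp (hi y) (tb_proj_holomorphic _).
have leafE (L : complexManifold R[i] d) (l : L -> Y) :
    is_leaf (im_k_eps H 1) l -> forall x v, V (l x) ->
    dlog (tau \o l) x v =
    pull1 l (pull1 (tb_proj \o i) (liouville rho beta)) x v.
  move=> [[_ _ [hl _] _ lD] _] x v Vlx.
  set y := l x in Vlx *; set w := mdiff l x v.
  have n10 : (1 : R[i]) != 0 by exact: oner_neq0.
  have hw : im_h_eps J (Some 1) (i y) (mdiff i y w).
    have : range (mdiff l x) w by exists v.
    by rewrite lD (assoc_conn H_assoc).
  have q1w : mdiff q1 (i y) (mdiff i y w) = 0.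
    exact: leaf_space_mdiff0 (twistor_leaves fibre1) hw.
  have [lin1 _] := jtau_holo1 tau_joyce (jtau_sub tau_joyce Vlx).
  have E0 := euler_contraction fibre1 hw (Omega_minus_isotropic y w Xact
    fibre_inf actZE j_embedding j_lagrangian j_invariant hi qij).
  have -> : dlog (tau \o l) x v = dlog tau y w.
    rewrite /dlog/= fdiff_comp//; exact: (jtau_holo tau_joyce).
  rewrite (jtau_dlog tau_joyce w Vlx) {1}/pull1 {2}/pull1 q1w (linear_fun0 lin1).
  rewrite subr0 {1}/pull1 addrAC E0 add0r /pull1 mdiff_comp//.
  exact: tb_proj_holomorphic.
split=> //; split.
- exact: (jtau_open tau_joyce).
- exact: (jtau_holo tau_joyce).
- exact: (jtau_neq0 tau_joyce).
move=> L l leaf x Vlx v; rewrite leafE// (assoc_varpi H_assoc).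
rewrite /pull1 /liouville.
have -> : base_map rho i = rho \o (tb_proj \o i) by [].
by rewrite -mdiff_comp.
Qed.
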